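(* Let $G$ be a graph with edge set $E$ and connectivity function $\gamma$, and let $\lambda$ be a connectivity function on $E$ with the property that $\lambda(Y)=\gamma(Y)$ for every $Y\subseteq E$ that is $e$-controlled for some edge $e$ of $G$. Then $\lambda=\gamma$.
   Context: A connectivity function on a finite set $E$ is a function $\lambda:2^E\to\mathbb R$ with $\lambda(\emptyset)=0$, $\lambda(X)=\lambda(E-X)$ for all $X\subseteq E$, and $\lambda(X\cap Y)+\lambda(X\cup Y)\le\lambda(X)+\lambda(Y)$ for all $X,Y\subseteq E$. For a graph $G$ without isolated vertices and $X\subseteq E(G)$, $V(X)$ is the set of vertices incident with an edge of $X$ and $\gamma(X)=|V(X)|+|V(E-X)|-|V(E)|$. For a vertex $v$, $S_v$ is the set of edges incident with $v$. For a set $S$, a subset $S'\subseteq S$ is controlled if $S'=S$, or $S'=\emptyset$, or $|S'|=1$. For an edge $e$ with endvertices $u,v$, a set $Y\subseteq E$ is $e$-controlled if it is the union of three controlled subsets, one of each of $S_u-\{e\}$, $S_v-\{e\}$ and $\{e\}$. *)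

(* Defs.v *)
From mathcomp Require Import all_boot all_order all_algebra.
From mathcomp Require Import reals.

Set Implicit Arguments.
Unset Strict Implicit.
Unset Printing Implicit Defensive.

Import GRing.Theory.
Local Open Scope ring_scope.

(* Finite undirected graphs; parallel edges and loops are allowed, a loop
   being an edge whose set of endvertices is a singleton. *)
Record graph := Graph {
  vertex : finType;
  edge : finType;
  ends : edge -> {set vertex};
  card_ends : forall e, (0 < #|ends e| <= 2)%N
}.

Definition no_isolated (G : graph) : Prop :=
  forall v : vertex G, exists e : edge G, v \in ends e.

Definition Vof (G : graph) (X : {set edge G}) : {set vertex G} :=
  [set v | [exists e in X, v \in ends e]].

Definition star (G : graph) (v : vertex G) : {set edge G} :=
  [set e | v \in ends e].

Definition gamma (R : realType) (G : graph) (X : {set edge G}) : R :=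
  #|Vof X|%:R + #|Vof (~: X)|%:R - #|Vof [set: edge G]|%:R.

Definition connectivity_function (R : realType) (E : finType)
    (lambda : {set E} -> R) : Prop :=
  [/\ lambda set0 = 0,
      forall X, lambda X = lambda (~: X) &
      forall X Y, lambda (X :&: Y) + lambda (X :|: Y) <= lambda X + lambda Y].

Definition controlled (T : finType) (S S' : {set T}) : Prop :=
  S' \subset S /\ [\/ S' = S, S' = set0 | #|S'| = 1%N].

(* [ends e = [set u; v]] determines u and v up to exchanging them, and forces
   u = v when e is a loop. *)
Definition e_controlled (G : graph) (e : edge G) (Y : {set edge G}) : Prop :=
  exists u v : vertex G, ends e = [set u; v] /\
  exists A B C : {set edge G},
    [/\ controlled (star u :\ e) A, controlled (star v :\ e) B,
        controlled [set e] C & Y = A :|: B :|: C].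

(* Main.v *)
Require Import Defs.
From mathcomp Require Import all_boot all_order all_algebra.
From mathcomp Require Import reals.
From mathcomp Require Import lra.

(* The defect D = gamma - lambda is nondecreasing under inclusion.  Indeed, the
   increment of gamma when e is added to X only depends, for each end w of e, on
   whether X meets S_w - e and whether X contains S_w - e.  Hence it is the same
   at some Y included in X such that both Y and Y + e are e-controlled, while by
   submodularity the increment of lambda at X is at most its increment at Y.
   As D vanishes on the empty set and, by symmetry, on E, it vanishes
   everywhere. *)

Set Implicit Arguments.
Unset Strict Implicit.
Unset Printing Implicit Defensive.

Import Order.TTheory GRing.Theory Num.Theory.
Local Open Scope ring_scope.

(** Induction on the size of [B :\: A]: the elements of [B] missing from [A] are added one at a
    time. *)
Lemma setU1_nondecreasing (R : realType) (T : finType) (D : {set T} -> R) :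
    (forall x (A : {set T}), x \notin A -> D A <= D (x |: A)) ->
  forall A B : {set T}, A \subset B -> D A <= D B.
Proof.
move=> incr A B; have [n] := ubnP #|B :\: A|.
elim: n A => // n IHn A; rewrite ltnS => leBAn sAB.
have [BA0 | [x]] := set_0Vmem (B :\: A).
  suff -> : A = B by [].
  by apply/eqP; rewrite eqEsubset sAB -setD_eq0 BA0 eqxx.
rewrite inE => /andP[xNA xB]; apply: le_trans (incr x A xNA) _.
apply: IHn; last by rewrite subUset sub1set xB.
apply: leq_trans leBAn; apply: proper_card; apply/properP; split.
  by apply: setDS; apply: subsetUr.
by exists x; rewrite !inE ?xNA ?eqxx.
Qed.

Lemma VofP (G : graph) (X : {set edge G}) (w : vertex G) :
  reflect (exists2 f, f \in X & w \in ends f) (w \in Vof X).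
Proof. by rewrite inE; apply: exists_inP. Qed.

Lemma Vof_setU1 (G : graph) (e : edge G) (X : {set edge G}) :
  Vof (e |: X) = ends e :|: Vof X.
Proof.
apply/setP=> w; rewrite in_setU; apply/VofP/orP => [[f] | [we | /VofP[f fX wf]]].
- by rewrite in_setU1 => /orP[/eqP-> | fX wf]; [left | right; apply/VofP; exists f].
- by exists e; rewrite ?setU11.
- by exists f; rewrite // in_setU1 fX orbT.
Qed.

Lemma card_Vof_setU1 (G : graph) (e : edge G) (X : {set edge G}) :
  #|Vof (e |: X)| = (#|Vof X| + #|ends e :\: Vof X|)%N.
Proof.
by rewrite Vof_setU1 -(cardsID (Vof X)) setIC setKU setDUl setDv setU0.
Qed.

(** Moving [e] into [X] gains the ends of [e] that [X] does not meet yet, and the complement loses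
    those that none of its other edges meets. *)
Lemma gamma_setU1 (R : realType) (G : graph) (e : edge G) (X : {set edge G}) :
    e \notin X ->
  gamma R (e |: X) =
  gamma R X + #|ends e :\: Vof X|%:R - #|ends e :\: Vof (~: (e |: X))|%:R.
Proof.
move=> eNX; rewrite /gamma card_Vof_setU1.
(* Read backwards, removing [e] from [~: X] is also an insertion, so one counting lemma serves both
   sides. *)
have -> : ~: X = e |: ~: (e |: X).
  by apply/setP=> f; rewrite !inE; case: eqP => // ->; rewrite eNX.
rewrite card_Vof_setU1 !natrD; lra.
Qed.

Lemma gamma0 (R : realType) (G : graph) : gamma R (set0 : {set edge G}) = 0.
Proof.
rewrite /gamma setC0; have -> : Vof (set0 : {set edge G}) = set0.
  by apply/setP=> w; rewrite in_set0; apply/VofP => -[f]; rewrite in_set0.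
by rewrite cards0; lra.
Qed.

Lemma gammaC (R : realType) (G : graph) (X : {set edge G}) :
  gamma R (~: X) = gamma R X.
Proof. by rewrite /gamma setCK [#|Vof (~: X)|%:R + _]addrC. Qed.

(** A controlled set inside [X] can record both whether [X] meets [S] and whether [X] contains [S]:
    take [S] itself if it lies in [X], otherwise one element of [S :&: X], or the empty set if there
    is none. *)
Lemma controlled_core (T : finType) (S X : {set T}) :
  exists A : {set T}, [/\ controlled S A, A \subset X,
    forall x, x \in S -> x \in X -> exists2 y, y \in S & y \in A &
    S \subset X -> S \subset A].
Proof.
have [sSX | nSX] := boolP (S \subset X).
  exists S; split=> //; last by move=> x xS _; exists x.
  by split=> //; constructor 1.
have [SX0 | [y]] := set_0Vmem (S :&: X).
  exists set0; split; rewrite ?sub0set //.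
    by split; [apply: sub0set | constructor 2].
  by move=> x xS xX; have := in_set0 x; rewrite -SX0 inE xS xX.
rewrite inE => /andP[yS yX]; exists [set y]; split.
- by split; [rewrite sub1set | constructor 3; rewrite cards1].
- by rewrite sub1set.
- by move=> x _ _; exists y; rewrite ?set11.
- by [].
Qed.

Lemma ends_pair (G : graph) (e : edge G) : exists u v, ends e = [set u; v].
Proof.
have := card_ends e; case def_n: #|ends e| => [|[|[|n]]] // _.
  by have /eqP/cards1P[u ->] := def_n; exists u, u; rewrite setUid.
by have /eqP/cards2P[u [v [_ ->]]] := def_n; exists u, v.
Qed.

(** [Y] is the union of the cores of [X] in the stars of the two ends, each without [e]. The third
    controlled piece is empty for [Y] and [[set e]] for [e |: Y]. *)
Lemma controlled_increment (G : graph) (e : edge G) (X : {set edge G}) :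
    e \notin X ->
  exists Y : {set edge G}, [/\ Y \subset X, e_controlled e Y,
    e_controlled e (e |: Y), ends e :\: Vof Y = ends e :\: Vof X &
    ends e :\: Vof (~: (e |: Y)) = ends e :\: Vof (~: (e |: X))].
Proof.
move=> eNX; have [u [v def_e]] := ends_pair e.
have [A [cA sAX metA fullA]] := controlled_core (star u :\ e) X.
have [B [cB sBX metB fullB]] := controlled_core (star v :\ e) X.
have sYX : A :|: B \subset X by rewrite subUset sAX.
have inS w f : w \in ends f -> f != e -> f \in star w :\ e.
  by move=> wf fe; rewrite !inE fe.
have met w f : w \in ends e -> w \in ends f -> f \in X ->
    exists2 g, w \in ends g & g \in A :|: B.
  move=> we wf fX; have fe : f != e by apply: contraNneq eNX => <-.
  move: we wf; rewrite def_e => /set2P[->|->] wf.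
    have [g] := metA f (inS _ _ wf fe) fX.
    by rewrite !inE => /andP[_ wg] gA; exists g; rewrite // inE gA.
  have [g] := metB f (inS _ _ wf fe) fX.
  by rewrite !inE => /andP[_ wg] gB; exists g; rewrite // inE gB orbT.
have full w : w \in ends e -> star w :\ e \subset X ->
    star w :\ e \subset A :|: B.
  rewrite def_e => /set2P[->|->].
    by move=> /fullA sA; apply: subset_trans sA (subsetUl _ _).
  by move=> /fullB sB; apply: subset_trans sB (subsetUr _ _).
exists (A :|: B); split=> //.
- exists u, v; split=> //; exists A, B, set0; split; rewrite ?setU0 //.
  by split; [apply: sub0set | constructor 2].
- exists u, v; split=> //; exists A, B, [set e]; split; rewrite 1?setUC //.
  by split=> //; constructor 1.
(* Only ends of [e] matter: [Y \subset X] gives one direction, [met] the other. *)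
- apply/setP=> w; rewrite !in_setD; case we: (w \in ends e); rewrite ?andbF //.
  congr (~~ _ && _); apply/VofP/VofP => [] [f fX wf].
    by exists f; rewrite // (subsetP sYX).
  by have [g wg gY] := met w f we wf fX; exists g.
- apply/setP=> w; rewrite !in_setD; case we: (w \in ends e); rewrite ?andbF //.
  congr (~~ _ && _); apply/VofP/VofP => [] [f]; rewrite in_setC in_setU1 negb_or.
    (* If [X] contained [star w :\ e], then so would [Y] by [full], contradicting [f \notin Y]. *)
    case/andP=> fe fNY wf; have /subsetPn[g] : ~~ (star w :\ e \subset X).
      apply: contra fNY => /(full w we)/subsetP; apply; exact: inS.
    rewrite in_setD1 inE => /andP[ge wg] gNX; exists g => //.
    by rewrite in_setC in_setU1 negb_or ge.
  case/andP=> fe fNX wf; exists f => //.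
  rewrite in_setC in_setU1 negb_or fe /=.
  by apply: contra fNX; apply: (subsetP sYX).
Qed.

Theorem theorem2 (R : realType) (G : graph) (hG : no_isolated G)
    (lambda : {set edge G} -> R)
    (hlambda : connectivity_function lambda)
    (hcontrolled : forall Y : {set edge G},
       (exists e : edge G, e_controlled e Y) -> lambda Y = gamma R Y) :
  forall X : {set edge G}, lambda X = gamma R X.
Proof.
have [lambda0 lambdaC submod] := hlambda.
have incr : forall e (X : {set edge G}), e \notin X ->
    gamma R X - lambda X <= gamma R (e |: X) - lambda (e |: X).
  move=> e X eNX.
  have [Y [sYX cY ceY eqV eqVC]] := controlled_increment eNX.
  have eNY : e \notin Y by apply: contra eNX; apply: (subsetP sYX).
  have lamY : lambda Y = gamma R Y by apply: hcontrolled; exists e.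
  have lameY : lambda (e |: Y) = gamma R (e |: Y) by apply: hcontrolled; exists e.
  (* These two sets have intersection [Y] and union [e |: X], so the increment of [lambda] at [X] is
     at most that at [Y], which equals the increment of [gamma] at [Y], hence at [X]. *)
  have := submod X (e |: Y).
  have -> : X :&: (e |: Y) = Y.
    apply/setP=> f; rewrite !inE; case: (eqVneq f e) => [->|_] /=.
      by rewrite (negPf eNX) (negPf eNY).
    by apply: andb_idl; apply: (subsetP sYX).
  have -> : X :|: (e |: Y) = e |: X by rewrite setUCA (setUidPl sYX).
  rewrite lamY lameY !gamma_setU1 // eqV eqVC; lra.
move=> X; have mono := setU1_nondecreasing incr.
have gammaT : gamma R [set: edge G] = 0 by rewrite -setC0 gammaC gamma0.
have lambdaT : lambda setT = 0 by rewrite -setC0 -lambdaC.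
have := mono _ _ (sub0set X); have := mono _ _ (subsetT X).
by rewrite lambda0 lambdaT gamma0 gammaT; lra.
Qed.
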